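(* Let $n$ be a positive integer and let $\Gamma=C_\infty\cdot\overline{K_n}$ (vertices $v_{ij}$, $i\in\mathbb Z$, $1\le j\le n$, with $v_{ij}$ adjacent to $v_{i'j'}$ iff $|i-i'|=1$). A coloring $\psi$ of $\Gamma$ with a finite set of colors is perfect if and only if it is of one of the following three kinds: (1) $\psi$ is a disjunctive coloring; (2) $\psi$ is bipartite and both of its semicolorings are $2$-periodic, i.e. for every $i\in\mathbb Z$ the multiset of colors of block $V_i$ equals the multiset of colors of block $V_{i+4}$ (the two semicolorings using disjoint sets of colors); (3) $\psi$ is non-bipartite, both of its semicolorings are $2$-periodic (the multiset of colors of $V_i$ equals that of $V_{i+4}$ for all $i$), and the two semicolorings are matched: $N_j(i-1)+N_j(i+1)=N_j(i)+N_j(i+2)$ for every color $j$ and every $i\in\mathbb Z$.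
   Context: $C_\infty$ is the graph on $\mathbb Z$ with $u\sim v$ iff $|u-v|=1$; $\overline{K_n}$ is the edgeless graph on $n$ vertices. The $i$-th block is $V_i=\{v_{i1},\dots,v_{in}\}$. A coloring with finitely many colors is perfect if there is a matrix $(m_{ab})$ such that every vertex of color $a$ has exactly $m_{ab}$ neighbours of color $b$, for all colors $a,b$. A coloring $\psi$ of $\Gamma$ is disjunctive if there are a perfect coloring $\chi:\mathbb Z\to\{1,\dots,k\}$ of $C_\infty$ and maps $\phi_1,\dots,\phi_k:\{1,\dots,n\}\to J_1,\dots,J_k$ with pairwise disjoint color sets $J_1,\dots,J_k$ such that $\psi(v_{ij})=\phi_{\chi(i)}(j)$. $\Gamma$ is bipartite with parts $\bigcup_{i \text{ even}}V_i$ and $\bigcup_{i\text{ odd}}V_i$; the restriction of $\psi$ to a part is a semicoloring. $\psi$ is bipartite if the sets of colors used on the two parts are disjoint, and non-bipartite otherwise. $N_j(i)$ denotes the number of vertices of color $j$ in block $V_i$.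
   Formalization: In kind (1), the coloring is required to be disjunctive only after renumbering the vertices inside each block, independently for each block; with a fixed numbering the ''only if'' direction fails (swap the two colors in one block of a 3-periodic disjunctive coloring with n = 2). *)

(* Defs.v *)
From mathcomp Require Import all_boot all_order all_algebra all_fingroup.
From mathcomp Require Import finmap.

Set Implicit Arguments.
Unset Strict Implicit.
Unset Printing Implicit Defensive.

Import GRing.Theory.
Local Open Scope ring_scope.

(* A possibly infinite graph is an adjacency relation on a choiceType.  The set
   of neighbours of a given color is required to be finite, of the prescribed
   cardinality.  The matrix is indexed by all of C; its rows at colors that
   psi does not use are unconstrained. *)
Definition perfect (V : choiceType) (adj : rel V) (C : finType) (psi : V -> C)
    : Prop :=
  exists m : C -> C -> nat, forall (a b : C) (v : V), psi v = a ->
    exists2 A : {fset V},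
      A =i [pred u | adj v u && (psi u == b)] & #|` A|%fset = m a b.

Definition Cinf : rel int := [rel u v : int | `|u - v| == 1].

(* The pair (i, j) is the vertex v_{i,j+1}, since 'I_n is {0, ..., n-1}. *)
Definition Gamma (n : nat) : rel (int * 'I_n) := [rel u v : int * 'I_n | Cinf u.1 v.1].

Definition disjunctive (n : nat) (C : finType) (psi : int * 'I_n -> C) : Prop :=
  exists (k : nat) (chi : int -> 'I_k) (J : 'I_k -> {set C})
         (phi : 'I_k -> 'I_n -> C),
    [/\ perfect Cinf chi,
        forall c d, c != d -> [disjoint J c & J d],
        forall c j, phi c j \in J c
      & forall i j, psi (i, j) = phi (chi i) j].

(* Renumbering the vertices inside each block, independently in every block.
   This is an automorphism of Gamma, and the blocks are unordered sets: a
   classification in terms of [disjunctive] is only meaningful up to such a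
   renumbering, because [disjunctive] itself refers to the numbering. *)
Definition renumber (n : nat) (C : finType) (s : int -> 'S_n)
    (psi : int * 'I_n -> C) : int * 'I_n -> C :=
  fun v => psi (v.1, s v.1 v.2).

Definition even_block (i : int) : bool := (2 %| i)%Z.

Definition bipartite (n : nat) (C : finType) (psi : int * 'I_n -> C) : Prop :=
  forall u v : int * 'I_n,
    even_block u.1 -> ~~ even_block v.1 -> psi u <> psi v.

Definition block_colors (n : nat) (C : finType) (psi : int * 'I_n -> C)
    (i : int) : seq C :=
  [seq psi (i, j) | j : 'I_n].

(* Equality of multisets is [perm_eq].  Consecutive blocks of one part are at
   distance 2, so period 2 within a part is a shift by 4 on block indices. *)
Definition semi_2periodic (n : nat) (C : finType) (psi : int * 'I_n -> C)
    : Prop :=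
  forall i : int, perm_eq (block_colors psi i) (block_colors psi (i + 4)).

Definition N (n : nat) (C : finType) (psi : int * 'I_n -> C) (a : C) (i : int)
    : nat :=
  #|[set j : 'I_n | psi (i, j) == a]|.

Definition matched (n : nat) (C : finType) (psi : int * 'I_n -> C) : Prop :=
  forall (a : C) (i : int),
    (N psi a (i - 1) + N psi a (i + 1) = N psi a i + N psi a (i + 2))%N.

(* Main.v *)
Require Import Defs.
From mathcomp Require Import all_boot all_order all_algebra all_fingroup.
From mathcomp Require Import finmap boolp zify.

(** Put [S i = N(i-1) + N(i+1)], a vector indexed by the colors.  The coloring
    is perfect iff [S] agrees on any two blocks sharing a color, so [i |-> S i]
    is a perfect coloring of the infinite path whose classes use disjoint sets of
    colors.  If [N] is constant on each class of [S], the coloring is disjunctive.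
    Otherwise let [N] be non-constant on a class [d].  A class adjacent to [d] and
    to another class would determine [N] on [d]; so both neighbours of any
    neighbour of [d] are in [d], and [d] contains all blocks of one parity.  Then
    [N] has period 4 on the other parity, hence so does [S], and on the parity of
    [d] we get [N(x+4k) = N(x) + k D], where [D = 0] by boundedness.  Hence
    [S(i) = S(i+2)] everywhere, which is 2-periodicity; a color common to both
    parts moreover forces [S] to be constant. *)

Set Implicit Arguments.
Unset Strict Implicit.
Unset Printing Implicit Defensive.

Import GRing.Theory Num.Theory.
Local Open Scope ring_scope.

(** * Perfection through finite neighbour lists, and tools for pairs, finite images and
    periodicity *)

Lemma perfectP (V : choiceType) (adj : rel V) (C : finType) (psi : V -> C)
    (nb : V -> seq V) :
    (forall v, uniq (nb v)) -> (forall v u, (u \in nb v) = adj v u) ->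
  perfect adj psi <-> forall v w, psi v = psi w ->
    forall b, count (fun u => psi u == b) (nb v) =
              count (fun u => psi u == b) (nb w).
Proof.
move=> nb_uniq nbE.
have card_nb b v (A : {fset V}) : A =i [pred u | adj v u && (psi u == b)] ->
    #|` A|%fset = count (fun u => psi u == b) (nb v).
  move=> AE; rewrite -size_filter; apply/perm_size/uniq_perm.
  - exact: fset_uniq.
  - exact: filter_uniq.
  - by move=> u; rewrite AE mem_filter inE nbE andbC.
split=> [[m mP] v w vw b|eq_nb].
  have [A /card_nb<- ->] := mP _ b v erefl.
  by have [B /card_nb<- ->] := mP _ b w (esym vw).
exists (fun a b => if pselect (exists v, psi v = a) is left ex_v then
  count (fun u => psi u == b) (nb (projT1 (cid ex_v))) else 0%N) => a b v va.
exists (seq_fset tt [seq u <- nb v | psi u == b]).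
  by move=> u; rewrite seq_fsetE mem_filter inE nbE andbC.
rewrite size_seq_fset undup_id ?filter_uniq // size_filter.
case: pselect => [ex_v|[]]; last by exists v.
by case: cid => w wa /=; apply: eq_nb; rewrite va wa.
Qed.

Lemma perfect_CinfP (C : finType) (chi : int -> C) :
  perfect Cinf chi <-> forall i k, chi i = chi k -> forall b,
    ((chi (i - 1)%R == b) + (chi (i + 1)%R == b) =
     (chi (k - 1)%R == b) + (chi (k + 1)%R == b))%N.
Proof.
rewrite (@perfectP _ _ _ _ (fun i => [:: i - 1; i + 1])).
- by split=> H i k ik b; have := H i k ik b; rewrite /= !addn0.
- by move=> i; rewrite /= inE andbT; apply/eqP; lia.
- by move=> i k; rewrite !inE /Cinf /=; lia.
Qed.

(** The multiplicities of [p] and [q] already add up to the full size 2. Testing only there matters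
    later: the counting hypothesis is available only for values that [around] attains. *)
Lemma pair_multiset_eq (T : eqType) (p q p' q' : T) :
    {in [:: p; q], forall c, (p == c) + (q == c) = (p' == c) + (q' == c)}%N ->
  (p = p' /\ q = q') \/ (p = q' /\ q = p').
Proof.
move=> H; have := H p; have := H q; rewrite !inE !eqxx orbT.
move=> /(_ isT) + /(_ isT).
rewrite (eq_sym p' p) (eq_sym q' p) (eq_sym q p) (eq_sym p' q) (eq_sym q' q).
by case: (p =P p'); case: (q =P q'); case: (p =P q'); case: (q =P p');
   case: (p =P q) => //=; intuition congruence.
Qed.

Lemma finite_image (I : Type) (T : finType) (f : I -> T) :
  exists k (chi : I -> 'I_k) (sec : 'I_k -> I),
    cancel sec chi /\ forall x y, chi x = chi y <-> f x = f y.
Proof.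
pose A := [set t | `[< exists i, f i = t >]].
have fA i : f i \in A by rewrite inE; apply/asboolP; exists i.
have /choice[sec secP] (c : 'I_#|A|) : exists i, f i = enum_val c.
  by have := enum_valP c; rewrite inE => /asboolP.
exists #|A|, (fun i => enum_rank_in (fA i) (f i)), sec; split=> [c|x y].
  by apply: enum_val_inj; rewrite enum_rankK_in.
split=> [/(congr1 enum_val)|fxy]; first by rewrite !enum_rankK_in.
by apply: enum_val_inj; rewrite !enum_rankK_in.
Qed.

Lemma period2_int (T : Type) (g : int -> T) :
  (forall i, g (i + 2) = g i) -> forall i k, g (i + 2 * k) = g i.
Proof.
move=> g2 i k; elim/int_rec: k => [|k IH|k IH].
- by rewrite mulr0 addr0.
- by rewrite -IH -[RHS]g2; congr g; lia.
- by rewrite -IH -[LHS]g2; congr g; lia.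
Qed.

Lemma period2_parity (T : Type) (g : int -> T) :
    (forall i, g (i + 2) = g i) ->
  forall i, g i = g (if even_block i then 0 else 1).
Proof.
move=> g2 i; rewrite /even_block; case: ifP => ev.
  by rewrite -(period2_int g2 0 (i %/ 2)%Z); congr g; lia.
by rewrite -(period2_int g2 1 (i %/ 2)%Z); congr g; lia.
Qed.

(** * Block counts, and the three kinds of coloring in terms of [around] *)

Section Coloring.

Variables (n : nat) (C : finType) (psi : int * 'I_n -> C).

Definition around (i : int) : {ffun C -> nat} :=
  [ffun a => (N psi a (i - 1) + N psi a (i + 1))%N].

Lemma N_count a i : N psi a i = count_mem a (block_colors psi i).
Proof.
by rewrite /N /block_colors count_map cardsE cardE -[RHS]size_filter enumT.
Qed.

Lemma perfect_GammaP :
  perfect (@Gamma n) psi <->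
  forall v w, psi v = psi w -> around v.1 = around w.1.
Proof.
pose nb (v : int * 'I_n) := [seq (v.1 - 1, j) | j <- enum 'I_n] ++
                            [seq (v.1 + 1, j) | j <- enum 'I_n].
have nb_count v b : count (fun u => psi u == b) (nb v) = around v.1 b.
  by rewrite ffunE !N_count /block_colors count_cat !count_map.
rewrite (@perfectP _ _ _ _ nb).
- split=> H v w vw; first by apply/ffunP=> b; rewrite -!nb_count (H v w).
  by move=> b; rewrite !nb_count (H v w).
- have uniq_row (x : int) : uniq [seq (x, j) | j <- enum 'I_n].
    by rewrite map_inj_uniq ?enum_uniq // => j k [].
  move=> v; rewrite cat_uniq !uniq_row andbT.
  apply/hasPn=> _ /mapP[j _ ->]; apply/mapP=> -[k _ []]; lia.
- move=> [i j] [k l]; rewrite mem_cat /Gamma /Cinf /=.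
  have mem_row (x : int) :
      ((k, l) \in [seq (x, j) | j <- enum 'I_n]) = (k == x).
    by apply/mapP/eqP=> [[h _ []]|->] //; exists l; rewrite ?mem_enum.
  by rewrite !mem_row; lia.
Qed.

Lemma semi_2periodicP :
  semi_2periodic psi <-> forall a (i : int), N psi a (i + 4) = N psi a i.
Proof.
split=> [H a i|H i]; first by rewrite !N_count (seq.permP (H i)).
by apply/allP=> a _; rewrite /= -!N_count H.
Qed.

(** [around] at [i] and at [i + 2] share the summand of block [i + 1], so their difference compares
    blocks [i - 1] and [i + 3]. *)
Lemma semi_2periodic_aroundP :
  semi_2periodic psi <-> forall i, around (i + 2) = around i.
Proof.
rewrite semi_2periodicP; split=> [H i|H a i].
  apply/ffunP=> a; rewrite !ffunE -(H a (i - 1)).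
  have -> : i + 2 - 1 = i + 1 by lia.
  have -> : i + 2 + 1 = i - 1 + 4 by lia.
  by rewrite addnC.
have /ffunP/(_ a) := H (i + 1); rewrite !ffunE.
have -> : i + 1 + 2 - 1 = i + 2 by lia.
have -> : i + 1 + 2 + 1 = i + 4 by lia.
have -> : i + 1 - 1 = i by lia.
have -> : i + 1 + 1 = i + 2 by lia.
lia.
Qed.

Lemma matchedP :
  matched psi <-> forall i, around (i + 1) = around i.
Proof.
have E : forall i : int, (i + 1 - 1 = i) * (i + 1 + 1 = i + 2).
  by move=> i; split; lia.
split=> H => [i|a i].
  by apply/ffunP=> a; have := H a i; rewrite !ffunE !E.
by have /ffunP/(_ a) := H i; rewrite !ffunE !E.
Qed.

Lemma N_gt0P a i : reflect (exists j, psi (i, j) = a) (0 < N psi a i)%N.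
Proof.
apply: (iffP card_gt0P) => [[j]|[j ja]].
  by rewrite inE => /eqP; exists j.
by exists j; rewrite inE ja.
Qed.

Lemma N_le a i : (N psi a i <= n)%N.
Proof. by rewrite -[leqRHS]card_ord max_card. Qed.

Lemma eq_N_perm i k :
  (forall a, N psi a i = N psi a k) ->
  exists s : 'S_n, forall j, psi (i, s j) = psi (k, j).
Proof.
move=> Nik.
pose t l := [tuple psi (l, j) | j < n].
have tE l : t l = block_colors psi l :> seq C by [].
have /tuple_permP[s sE] : perm_eq (t k) (t i).
  by apply/allP=> a _; rewrite /= !tE -!N_count Nik.
exists s => j.
have /(congr1 (fun u => tnth u j)) :
    t k = [tuple tnth (t i) (s j) | j < n] by apply: val_inj.
by rewrite !tnth_mktuple.
Qed.

End Coloring.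

Lemma N_renumber (n : nat) (C : finType) (s : int -> 'S_n)
    (psi : int * 'I_n -> C) a i : N (renumber s psi) a i = N psi a i.
Proof.
rewrite /N -(card_imset _ (@perm_inj _ (s i))); congr #|pred_of_set _|.
apply/setP=> j; rewrite inE; apply/imsetP/idP=> [[k + ->]|ja].
  by rewrite inE.
by exists ((s i)^-1%g j); rewrite ?inE /renumber /= permKV.
Qed.

(** Disjointness of the [J c] lets a color determine [chi] of its block. Counts depend only on
    [chi], whose perfection fixes the two neighbouring values up to order. *)
Lemma disjunctive_perfect (n : nat) (C : finType) (s : int -> 'S_n)
    (psi : int * 'I_n -> C) :
  disjunctive (renumber s psi) -> perfect (@Gamma n) psi.
Proof.
move=> [k [chi [J [phi [/perfect_CinfP chiP disJ phiJ psiE]]]]].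
have NE a i : N psi a i = #|[set j | phi (chi i) j == a]|.
  by rewrite -(N_renumber s) /N; under eq_finset do rewrite psiE.
have psiJ v : psi v \in J (chi v.1).
  case: v => i j; have := psiE i ((s i)^-1%g j).
  by rewrite /renumber /= permKV => ->.
apply/perfect_GammaP=> v w vw.
have chi_vw : chi v.1 = chi w.1.
  apply/eqP/negPn/negP=> /disJ/disjointFr/(_ (psiJ v)).
  by rewrite vw psiJ.
apply/ffunP=> a; rewrite !ffunE !NE.
by have [|[-> ->]|[-> ->]] := @pair_multiset_eq _ (chi (v.1 - 1)) (chi (v.1 + 1))
  (chi (w.1 - 1)) (chi (w.1 + 1)); [move=> c _; apply: chiP| |rewrite addnC].
Qed.

(** * The perfect coloring of the path by the values of [around] *)

Definition side (b : bool) (i : int) : int := if b then i + 1 else i - 1.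

Lemma sideK b : cancel (side b) (side (~~ b)).
Proof. by move=> i; case: b; rewrite /side /= ?addrK ?subrK. Qed.

Section Perfect.

Variables (n : nat) (C : finType) (psi : int * 'I_n -> C).
Hypothesis n_gt0 : (0 < n)%N.
Hypothesis psi_perfect :
  forall v w, psi v = psi w -> around psi v.1 = around psi w.1.

Local Notation S := (around psi).

Lemma around_side b i a : S i a = (N psi a (side b i) + N psi a (side (~~ b) i))%N.
Proof. by rewrite ffunE; case: b; rewrite // addnC. Qed.

Lemma shared_color a i k :
  (0 < N psi a i)%N -> (0 < N psi a k)%N -> S i = S k.
Proof.
move=> /N_gt0P[j ij] /N_gt0P[l kl].
by apply: (@psi_perfect (i, j) (k, l)); rewrite ij.
Qed.

Lemma eq_N_around i k : (forall a, N psi a i = N psi a k) -> S i = S k.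
Proof.
move=> Nik; pose a := psi (i, Ordinal n_gt0).
have a_i : (0 < N psi a i)%N by apply/N_gt0P; exists (Ordinal n_gt0).
by apply: (@shared_color a); rewrite -?Nik.
Qed.

Definition palette (i : int) : {set C} :=
  [set a | `[< exists2 v, S v.1 = S i & psi v = a >]].

Lemma mem_palette v i : (psi v \in palette i) = (S v.1 == S i).
Proof.
rewrite inE; apply/asboolP/eqP=> [[w <- wv]|]; last by exists v.
exact: psi_perfect.
Qed.

(** A palette contains either all [n] vertices of a block or none, which turns equality of classes
    into a linear count. *)
Lemma sum_palette i k : (\sum_(a in palette k) N psi a i = n * (S i == S k))%N.
Proof.
transitivity (\sum_(a in palette k) \sum_(j < n) (psi (i, j) == a))%N.
  apply: eq_bigr => a _; rewrite /N -sum1_card big_mkcond /=.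
  by apply: eq_bigr => j _; rewrite inE; case: eqP.
rewrite exchange_big /=.
transitivity (\sum_(j < n) (S i == S k))%N; last by rewrite sum_nat_const card_ord.
apply: eq_bigr => j _; rewrite -(mem_palette (i, j)).
case: (boolP (_ \in _)) => ij.
  rewrite (bigD1 (psi (i, j))) //= eqxx big1 // => a /andP[_ /negPf aj].
  by rewrite eq_sym aj.
by rewrite big1 // => a aP; case: eqP ij => // ->; rewrite aP.
Qed.

(** Sum the equality [S i = S k] over the palette of [t] and divide by [n]. *)
Lemma around_nb_count i k t : S i = S k ->
  ((S (i - 1) == S t) + (S (i + 1) == S t) =
   (S (k - 1) == S t) + (S (k + 1) == S t))%N.
Proof.
move=> Sik; apply/eqP; rewrite -(eqn_pmul2l n_gt0) !mulnDr -!sum_palette.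
rewrite -!big_split /=; apply/eqP/eq_bigr => a _.
by have /ffunP/(_ a) := Sik; rewrite !ffunE.
Qed.

Lemma around_side_eq i k b : S i = S k -> exists b',
  S (side b i) = S (side b' k) /\ S (side (~~ b) i) = S (side (~~ b') k).
Proof.
move=> Sik.
have [c||[]] := @pair_multiset_eq _ (S (i - 1)) (S (i + 1)) (S (k - 1)) (S (k + 1)).
- by rewrite !inE => /orP[]/eqP->; apply: around_nb_count.
- by case=> E1 E2; exists b; case: b.
- by move=> E1 E2; exists (~~ b); case: b.
Qed.

(** Blocks of different classes share no color, so each entry of [S i] comes from one side only. *)
Lemma N_side_eq i k b b' a :
    S i = S k -> S (side b i) = S (side b' k) ->
    S (side (~~ b) i) = S (side (~~ b') k) ->
    S (side (~~ b) i) <> S (side b i) ->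
  N psi a (side b i) = N psi a (side b' k).
Proof.
move=> /ffunP/(_ a) Sik Seq Seq' Sneq.
rewrite (around_side b) (around_side b') in Sik.
have excl u w : S u <> S w -> (0 < N psi a w)%N -> N psi a u = 0%N.
  move=> Suw w_gt0; case: (posnP (N psi a u)) => // u_gt0.
  by case: Suw; apply: shared_color u_gt0 w_gt0.
(* If [a] occurs in either block of the other class, it is absent from both blocks compared;
   otherwise the equality of sums is the claim. *)
have := excl (side b i) (side (~~ b) i).
have := excl (side b i) (side (~~ b') k).
have := excl (side b' k) (side (~~ b) i).
have := excl (side b' k) (side (~~ b') k).
rewrite -Seq -Seq' => /(_ (nesym Sneq)) E1 /(_ (nesym Sneq)) E2.
move=> /(_ (nesym Sneq)) E3 /(_ (nesym Sneq)) E4; lia.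
Qed.

(** * A class on which the block counts are not constant *)

Section NonConstantClass.

Variables (u0 u1 : int) (a0 : C).
Hypothesis S_u : S u0 = S u1.
Hypothesis N_u : N psi a0 u0 <> N psi a0 u1.

Lemma nonconst_class_step b v : S v = S u0 -> S (side b (side b v)) = S u0.
Proof.
move=> Sv; apply: contrapT => Sneq; apply: N_u.
set i := side b v in Sneq *.
(* Every block [u] of the class of [u0] is next to a block [j] that has the same two neighbouring
   classes as [i]; [N_side_eq] then equates the counts at [u0] and [u1]. *)
have pull u : S u = S u0 -> exists j d, [/\ S j = S i, side d j = u
    & S (side (~~ d) j) = S (side b i)].
  move=> Su; have [c [Sc _]] := @around_side_eq v u b (etrans Sv (esym Su)).
  have [c' [Sc1 Sc2]] := @around_side_eq (side c u) i (~~ c) (esym Sc).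
  exists (side c u), (~~ c); split; rewrite ?sideK // Sc2.
  (* The value [c' = b] would put [side b i] in the class of [u0], against [Sneq]. *)
  have -> // : c' = ~~ b.
    case: (eqVneq c' b) Sc1 => [->|]; last by move: (c') (b) => [] [].
    by rewrite sideK Su => /esym.
  by rewrite negbK.
have [j0 [d0 [S0 E0 F0]]] := pull u0 erefl.
have [j1 [d1 [S1 E1 F1]]] := pull u1 (esym S_u).
rewrite -E0 -E1; apply: N_side_eq.
- by rewrite S0.
- by rewrite E0 E1.
- by rewrite F0 F1.
- by rewrite F0 E0.
Qed.

Lemma nonconst_class_parity t : S (u0 + 2 * t) = S u0.
Proof.
elim/int_rec: t => [|t /(nonconst_class_step true)|t /(nonconst_class_step false)].
- by rewrite mulr0 addr0.
- by move=> <-; congr S; rewrite /side; lia.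
- by move=> <-; congr S; rewrite /side; lia.
Qed.

(** Two consecutive blocks of the parity of [u0] have equal [around]; cancel the block between
    them. *)
Lemma nonconst_class_other_parity t a :
  N psi a (u0 + 1 + 2 * t + 4) = N psi a (u0 + 1 + 2 * t).
Proof.
have := nonconst_class_parity (t + 1).
rewrite -(nonconst_class_parity (t + 2)) => /ffunP/(_ a); rewrite !ffunE.
have -> : u0 + 2 * (t + 1) - 1 = u0 + 1 + 2 * t by lia.
have -> : u0 + 2 * (t + 1) + 1 = u0 + 1 + 2 * t + 2 by lia.
have -> : u0 + 2 * (t + 2) - 1 = u0 + 1 + 2 * t + 2 by lia.
have -> : u0 + 2 * (t + 2) + 1 = u0 + 1 + 2 * t + 4 by lia.
lia.
Qed.

Lemma nonconst_class_other_around t :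
  S (u0 + 1 + 2 * t + 2) = S (u0 + 1 + 2 * t).
Proof.
pose x := u0 + 2 * t.
have S4 s : S (u0 + 1 + 2 * s + 4) = S (u0 + 1 + 2 * s).
  by apply: eq_N_around => a; rewrite nonconst_class_other_parity.
have S4k (k : nat) s : S (u0 + 1 + 2 * s + 4 * k%:Z) = S (u0 + 1 + 2 * s).
  elim: k => [|k IH]; first by rewrite mulr0 addr0.
  by rewrite -IH; have := S4 (s + 2 * k%:Z); congr (S _ = S _); lia.
(* Each shift by 4 changes the count by [S (u0 + 1 + 2 * t + 2) a - S (u0 + 1 + 2 * t) a]; the form
   without subtraction avoids truncation in [nat]. *)
have drift (k : nat) a : (N psi a (x + 4 * k%:Z) + k * S (u0 + 1 + 2 * t) a =
    N psi a x + k * S (u0 + 1 + 2 * t + 2) a)%N.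
  elim: k => [|k IH]; first by rewrite mulr0 addr0.
  have := congr1 (fun f : {ffun _} => f a) (S4k k t).
  have := congr1 (fun f : {ffun _} => f a) (S4k k (t + 1)).
  have -> : u0 + 1 + 2 * (t + 1) = u0 + 1 + 2 * t + 2 by lia.
  rewrite [in X in X -> _]ffunE [in X in _ -> X -> _]ffunE /x.
  have -> : u0 + 1 + 2 * t + 2 + 4 * k%:Z - 1 = x + 4 * k%:Z + 2 by lia.
  have -> : u0 + 1 + 2 * t + 2 + 4 * k%:Z + 1 = x + 4 * k.+1%:Z by lia.
  have -> : u0 + 1 + 2 * t + 4 * k%:Z - 1 = x + 4 * k%:Z by lia.
  have -> : u0 + 1 + 2 * t + 4 * k%:Z + 1 = x + 4 * k%:Z + 2 by lia.
  rewrite /x in IH *; nia.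
(* After [n.+1] shifts a nonzero drift would move the count by more than [n], yet counts stay
   between 0 and [n]. *)
apply/ffunP=> a; have := drift n.+1 a.
have := N_le psi a x; have := N_le psi a (x + 4 * n.+1%:Z).
nia.
Qed.

Lemma nonconst_class_semi_2periodic : semi_2periodic psi.
Proof.
apply/semi_2periodic_aroundP => i.
have [t [->|->]] : exists t, i = u0 + 2 * t \/ i = u0 + 1 + 2 * t.
  by exists ((i - u0) %/ 2)%Z; lia.
- have -> : u0 + 2 * t + 2 = u0 + 2 * (t + 1) by lia.
  by rewrite !nonconst_class_parity.
- exact: nonconst_class_other_around.
Qed.

End NonConstantClass.

(** Take the classes as [chi] and their palettes as [J], and renumber each block to copy a
    representative block of its class. *)
Lemma const_class_disjunctive :
    (forall i k a, S i = S k -> N psi a i = N psi a k) ->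
  exists s : int -> 'S_n, disjunctive (renumber s psi).
Proof.
move=> N_class.
(* The values of [around] lie in an infinite type, so classes are numbered through their palettes,
   which separate them because blocks are nonempty. *)
have [k [chi [sec [secK chiE]]]] := finite_image palette.
have chiP i l : chi i = chi l <-> S i = S l.
  rewrite chiE; split=> [pil|Sil].
    apply/eqP; rewrite -(mem_palette (i, Ordinal n_gt0)) -pil.
    by rewrite mem_palette.
  by apply/setP=> a; rewrite !inE Sil.
have /choice[s sP] i : exists s : 'S_n,
    forall j, psi (i, s j) = psi (sec (chi i), j).
  by apply: eq_N_perm => a; apply/N_class/chiP; rewrite secK.
exists s, k, chi, (fun c => palette (sec c)), (fun c j => psi (sec c, j)).
split=> [|c d|c j|i j].
- apply/perfect_CinfP => i l /chiP Sil c.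
  have chi_eqb x : (chi x == c) = (S x == S (sec c)).
    by rewrite -{1}[c]secK; apply/eqP/eqP => /chiP.
  by rewrite !chi_eqb; apply: around_nb_count.
- apply: contraR => /pred0Pn[a /andP[/=]].
  rewrite !inE => /asboolP[v Sv <-] /asboolP[w Sw /esym /psi_perfect].
  by rewrite Sv Sw => /chiP; rewrite !secK => ->.
- by rewrite mem_palette.
- exact: sP.
Qed.

End Perfect.

Theorem theorem1 (n : nat) (n_gt0 : (0 < n)%N) (C : finType)
    (psi : int * 'I_n -> C) :
  perfect (@Gamma n) psi <->
  [\/ exists s : int -> 'S_n, disjunctive (renumber s psi),
      bipartite psi /\ semi_2periodic psi
    | [/\ ~ bipartite psi, semi_2periodic psi & matched psi]].
Proof.
split=> [/perfect_GammaP psiP|].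
  have [N_class|nclass] :=
      pselect (forall i k a, around psi i = around psi k -> N psi a i = N psi a k).
    by apply: Or31; apply: const_class_disjunctive.
  have per : semi_2periodic psi.
    apply: contrapT => nper; apply: nclass => i k a Sik.
    apply: contrapT => Nik; apply: nper.
    exact: (nonconst_class_semi_2periodic n_gt0 psiP Sik Nik).
  have [bip|nbip] := pselect (bipartite psi); [exact: Or32|apply: Or33].
  split=> //; apply/matchedP => i.
  have /semi_2periodic_aroundP/period2_parity S2 := per.
  (* [around] depends only on parity here, so distinct values would forbid a color common to both
     parts. *)
  have S01 : around psi 0 = around psi 1.
    apply: contrapT => S01; apply: nbip => u v ev_u odd_v /psiP.
    by rewrite S2 ev_u (S2 v.1) (negPf odd_v).
  by rewrite S2 (S2 i); do 2![case: ifP => _].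
case=> [[s]|[bip per]|[_ _ mat]].
- exact: disjunctive_perfect.
- apply/perfect_GammaP => v w vw.
  have /semi_2periodic_aroundP/period2_parity S2 := per.
  rewrite S2 (S2 w.1); case: ifPn => ev_v; case: ifPn => // ev_w.
    by case: (bip _ _ ev_v ev_w).
  by case: (bip _ _ ev_w ev_v).
- apply/perfect_GammaP => v w _.
  have /matchedP S1 := mat.
  have S2 i : around psi (i + 2) = around psi i.
    by rewrite -(S1 i) -(S1 (i + 1)); congr around; lia.
  have S01 : around psi 0 = around psi 1 by rewrite -(S1 0) add0r.
  by rewrite (period2_parity S2) (period2_parity S2 w.1); do 2![case: ifP => _].
Qed.
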